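(* Let $\Omega\subset\mathbb{R}^n$ be a bounded domain, $p>0$, $\lambda,\kappa,\gamma>0$, $\alpha,\beta\in\mathbb{R}$. Let $\mu\ge\gamma$ and let $N$ be a positive integer large enough that $\lambda_{N+1}>\frac{\gamma}{\lambda}$. Let $u$ be a sufficiently smooth complex-valued solution of $$u_t-(\lambda+i\alpha)\Delta u+(\kappa+i\beta)|u|^p u-\gamma u=-\mu\sum_{k=1}^{N}(u,\omega_k)\,\omega_k,\quad x\in\Omega,\ t>0,$$ $$u=0\ \text{ on }\partial\Omega,\ t>0,\qquad u(x,0)=u_0(x),\quad x\in\Omega.$$ Then there exists $\omega>0$ such that $$\|u(t)\|_{L^2(\Omega)}^2\le e^{-\omega t}\|u_0\|_{L^2(\Omega)}^2\quad\text{for all } t\ge 0;$$ indeed, this holds with $\omega=2(\lambda-\gamma\lambda_{N+1}^{-1})\lambda_1$.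
   Context: $(\cdot,\cdot)$ is the inner product $(f,g)=\int_\Omega f\bar g\,dx$ of $L^2(\Omega)$. $(\omega_k)_{k\ge1}$ is an orthonormal basis of $L^2(\Omega)$ consisting of eigenfunctions of $-\Delta$ with homogeneous Dirichlet boundary condition, with corresponding eigenvalues $0<\lambda_1\le\lambda_2\le\cdots$, $\lambda_k\to\infty$, counted with multiplicity. (The parameter $\lambda$ without index is a coefficient of the equation, not an eigenvalue.) The existence of the solution is assumed. ''Sufficiently smooth'' means regular enough in time and space that one may multiply the equation by $\bar u$, integrate over $\Omega$, integrate by parts and differentiate $\|u(t)\|_{L^2}^2$ in time; for definiteness one may take $u\in C([0,\infty);H^2(\Omega)\cap H^1_0(\Omega))\cap C^1([0,\infty);L^2(\Omega))$. *)

(* Defs.v *)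
From HB Require Import structures.
From mathcomp Require Import all_boot all_order all_algebra.
From mathcomp Require Import complex.
From mathcomp Require Import all_classical all_reals all_analysis.
From mathcomp Require Import measurable_realfun.

Set Implicit Arguments.
Unset Strict Implicit.
Unset Printing Implicit Defensive.

Import Order.TTheory GRing.Theory Num.Theory.
Import numFieldNormedType.Exports.
Import ComplexField ComplexField.Normc.

Local Open Scope classical_set_scope.
Local Open Scope ring_scope.

HB.instance Definition _ (R : realType) (n : nat) :=
  @isMeasurable.Build (sigma_display (@open 'rV[R]_n)) 'rV[R]_n
    <<s @open 'rV[R]_n >> (@sigma_algebra0 _ setT _)
    (@sigma_algebraC _ (@open 'rV[R]_n)) (@sigma_algebra_bigcup _ setT _).

Section borel_rV.
Variable R : realType.

Lemma measurable_coord n (j : 'I_n) :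
  measurable_fun [set: 'rV[R]_n] (fun v => v ord0 j).
Proof.
apply: (measurability _ (RGenOInfty.measurableE R)) => _ [_ [a ->] <-].
rewrite setTI; apply: sub_sigma_algebra.
apply: open_comp; last exact: interval_open.
by move=> v _; exact: coord_continuous.
Qed.

Lemma measurable_rowP d (T : measurableType d) n (f : T -> 'rV[R]_n) :
  (forall j, measurable_fun [set: T] (fun x => f x ord0 j)) ->
  measurable_fun [set: T] f.
Proof.
move=> mf.
apply: (@measurability _ _ _ _ _ _ (@open 'rV[R]_n)) => // _ [U oU <-].
rewrite setTI.
pose box (i : 'rV[rat]_n * nat) : set 'rV[R]_n :=
  [set v | forall j, `|v ord0 j - ratr (i.1 ord0 j)| < i.2.+1%:R^-1].
have -> : f @^-1` U = \bigcup_(i : 'rV[rat]_n * nat)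
    (if `[< box i `<=` U >] then f @^-1` box i else set0).
  apply/seteqP; split=> [x /= Ufx|x [i _]]; last by case: asboolP => // bU /bU.
  have /nbhs_ballP[e e0 eU] := open_nbhs_nbhs (conj oU Ufx).
  have e20 : 0 < e / 2 by rewrite divr_gt0.
  have [k _ /(_ k (leqnn k)) /= ke] := near_infty_natSinv_lt (PosNum e20).
  have /choice[q qP] : forall j, exists q : rat, `|f x ord0 j - ratr q| < k.+1%:R^-1.
    move=> j.
    have [|q] := @rat_in_itvoo R (f x ord0 j - k.+1%:R^-1)
      (f x ord0 j + k.+1%:R^-1).
      by rewrite ltrD2l gt0_cp// invr_gt0.
    by rewrite in_itv/= => qP; exists q; rewrite distrC ltr_distl.
  exists (\row_j q j, k) => //=; case: asboolP => [_ j /=|[v bv]]; first by rewrite mxE.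
  apply: eU; split => // i j; rewrite ord1.
  have := bv j; rewrite /= mxE => h.
  rewrite /ball/= (le_lt_trans (ler_distD (ratr (q j)) _ _))//.
  rewrite [e]splitr ltrD// ?(lt_trans (qP j))//.
  by rewrite distrC (lt_trans h).
apply: countable_bigcupT_measurable => // i; case: ifP => // _.
rewrite (_ : _ @^-1` _ = \bigcap_(j : 'I_n)
  ((fun x => f x ord0 j) @^-1` [set y | `|y - ratr (i.1 ord0 j)| < i.2.+1%:R^-1])); last first.
  by apply/seteqP; split=> x /= bx j; [move=> _|]; exact: bx.
apply: fin_bigcap_measurable => // j _.
rewrite -[X in measurable X]setTI; apply: mf => //.
apply: open_measurable.
rewrite (_ : mkset _ = `](ratr (i.1 ord0 j) - i.2.+1%:R^-1),
                         (ratr (i.1 ord0 j) + i.2.+1%:R^-1)[%classic).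
  exact: interval_open.
by apply/seteqP; split => y /=; rewrite in_itv/= ltr_distl.
Qed.

End borel_rV.

Section lebesgue_rV.
Variable R : realType.
Implicit Type n : nat.

Definition cons_rV n (p : measurableTypeR R * 'rV[R]_n) : 'rV[R]_n.+1 :=
  \row_j (if unlift ord0 j is Some k then p.2 ord0 k else (p.1 : R)).

Definition uncons_rV n (v : 'rV[R]_n.+1) : measurableTypeR R * 'rV[R]_n :=
  (v ord0 ord0, \row_k v ord0 (lift ord0 k)).

Lemma uncons_rVK n : cancel (@uncons_rV n) (@cons_rV n).
Proof.
by move=> v; apply/rowP => j; rewrite mxE; case: unliftP => [k|] -> /=;
  rewrite ?mxE.
Qed.

Lemma cons_rVK n : cancel (@cons_rV n) (@uncons_rV n).
Proof.
case=> x v; congr pair; first by rewrite mxE unlift_none.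
by apply/rowP => k; rewrite !mxE liftK.
Qed.

Lemma measurable_cons_rV n : measurable_fun [set: _ * _] (@cons_rV n).
Proof.
apply: measurable_rowP => j; case: (unliftP ord0 j) => [k|] ->.
- rewrite (_ : (fun _ => _) = (fun v : 'rV[R]_n => v ord0 k) \o snd).
    by apply: measurableT_comp; [exact: measurable_coord|exact: measurable_snd].
  by apply/funext => p /=; rewrite mxE liftK.
- rewrite (_ : (fun _ => _) = fst); first exact: measurable_fst.
  by apply/funext => p; rewrite mxE unlift_none.
Qed.

Lemma measurable_uncons_rV n : measurable_fun [set: 'rV[R]_n.+1] (@uncons_rV n).
Proof.
apply/measurable_fun_pairP; split; first exact: measurable_coord.
apply: measurable_rowP => j.
rewrite (_ : (fun _ => _) = fun v : 'rV[R]_n.+1 => v ord0 (lift ord0 j)).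
  exact: measurable_coord.
by apply/funext => v; rewrite /= mxE.
Qed.

Section step.
Variables (n : nat) (mu : {sigma_finite_measure set 'rV[R]_n -> \bar R}).

Definition lebesgue_step : set 'rV[R]_n.+1 -> \bar R :=
  pushforward (lebesgue_measure \x mu)%E (@cons_rV n).

Let lebesgue_step0 : lebesgue_step set0 = 0%E.
Proof. by rewrite /lebesgue_step /pushforward preimage_set0 measure0. Qed.

Let lebesgue_step_ge0 A : (0 <= lebesgue_step A)%E.
Proof. by rewrite /lebesgue_step /pushforward measure_ge0. Qed.

Let lebesgue_step_sigma_additive : semi_sigma_additive lebesgue_step.
Proof.
exact: (@measure_semi_sigma_additive _ _ _
  (measure_function_pushforward__canonical__measure_function_Measure
    (product_measure1 lebesgue_measure mu) (@measurable_cons_rV n))).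
Qed.

HB.instance Definition _ := isMeasure.Build _ _ _ lebesgue_step
  lebesgue_step0 lebesgue_step_ge0 lebesgue_step_sigma_additive.

Let lebesgue_step_sigma_finite : sigma_finite setT lebesgue_step.
Proof.
have /sigma_finiteP[F [TF ndF Foo]] := sigma_finiteT (@lebesgue_measure R).
have /sigma_finiteP[G [TG ndG Goo]] := sigma_finiteT mu.
exists (fun k => @uncons_rV n @^-1` (F k `*` G k)).
  rewrite -preimage_bigcup; apply/seteqP; split => // v _.
  have [i _ Fi] : (\bigcup_i F i) (uncons_rV v).1 by rewrite -TF.
  have [j _ Gj] : (\bigcup_j G j) (uncons_rV v).2 by rewrite -TG.
  exists (maxn i j) => //; split.
    by move: Fi; exact/subsetPset/ndF/leq_maxl.
  by move: Gj; exact/subsetPset/ndG/leq_maxr.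
move=> k; have [mF Fk] := Foo k; have [mG Gk] := Goo k; split.
  rewrite -[X in measurable X]setTI; apply: measurable_uncons_rV => //.
  exact: measurableX.
rewrite /lebesgue_step /pushforward -comp_preimage.
rewrite (_ : _ \o _ = id) ?preimage_id; last first.
  by apply/funext => p /=; rewrite cons_rVK.
by rewrite product_measure1E// lte_mul_pinfty// ge0_fin_numE.
Qed.

HB.instance Definition _ := Measure_isSigmaFinite.Build _ _ _ lebesgue_step
  lebesgue_step_sigma_finite.

End step.

Fixpoint lebesgue_rV n : {sigma_finite_measure set 'rV[R]_n -> \bar R} :=
  match n with
  | 0%N => \d_(0 : 'rV[R]_0)
  | m.+1 => lebesgue_step (lebesgue_rV m)
  end.

Lemma lebesgue_rV_box n (a b : 'rV[R]_n) : (forall j, a ord0 j <= b ord0 j) ->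
  lebesgue_rV n [set v | forall j, a ord0 j <= v ord0 j <= b ord0 j] =
  (\prod_(j < n) (b ord0 j - a ord0 j))%:E.
Proof.
elim: n a b => [|n IHn] a b ab.
  by rewrite big_ord0 /= diracE mem_set// => -[].
rewrite big_ord_recl EFinM /= /lebesgue_step /pushforward.
pose A : set (measurableTypeR R) := `[a ord0 ord0, b ord0 ord0]%classic.
pose B := [set v : 'rV[R]_n | forall j,
  (uncons_rV a).2 ord0 j <= v ord0 j <= (uncons_rV b).2 ord0 j].
have -> : @cons_rV n @^-1` [set v | forall j, a ord0 j <= v ord0 j <= b ord0 j]
    = A `*` B.
  apply/seteqP; split=> [[x v] /= abv|[x v] [/= Ax Bv] j].
    split; first by have := abv ord0; rewrite /A/= in_itv/= mxE unlift_none.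
    by move=> j; have := abv (lift ord0 j); rewrite !mxE liftK.
  rewrite mxE; case: unliftP => [k|] ->; last by move: Ax; rewrite /A/= in_itv.
  by have := Bv k; rewrite !mxE.
rewrite product_measure1E//; last 2 first.
- exact: measurable_itv.
- rewrite (_ : B = \bigcap_(j : 'I_n) ((fun v : 'rV[R]_n => v ord0 j) @^-1`
      `[(uncons_rV a).2 ord0 j, (uncons_rV b).2 ord0 j]%classic)).
    apply: fin_bigcap_measurable => // j _.
    by rewrite -[X in measurable X]setTI; apply: measurable_coord => //;
      exact: measurable_itv.
  by apply/seteqP; split=> v Bv j; [move=> _|]; have := Bv j;
    rewrite /= in_itv//=; exact.
congr (_ * _)%E.
  rewrite [LHS](lebesgue_measure_itv `[a ord0 ord0, b ord0 ord0]) /= lte_fin.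
  case: ltgtP (ab ord0) => // ->.
  by rewrite subrr.
rewrite IHn; first by congr EFin; apply: eq_bigr => j _; rewrite !mxE.
by move=> j; rewrite !mxE.
Qed.

End lebesgue_rV.

Arguments lebesgue_rV {R n}.

Definition is_domain (R : realType) n (Om : set 'rV[R]_n) :=
  [/\ open Om, connected Om & Om !=set0].

Section function_spaces.
Local Open Scope complex_scope.
Variables (R : realType) (n : nat) (Om : set 'rV[R]_n).
Implicit Types (f g phi : 'rV[R]_n -> R[i]) (j : 'I_n).

Definition Cintegral f : R[i] :=
  (\int[lebesgue_rV]_(x in Om) complex.Re (f x)) +i*
  (\int[lebesgue_rV]_(x in Om) complex.Im (f x)).

(* A function on Om is a total function considered on Om only; elements of the
   Lebesgue and Sobolev spaces are represented by functions, not by classes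
   modulo equality almost everywhere. *)
Definition L2 f :=
  [/\ measurable_fun Om (fun x => complex.Re (f x)),
      measurable_fun Om (fun x => complex.Im (f x)) &
      (\int[lebesgue_rV]_(x in Om) (normc (f x) ^+ 2)%:E < +oo)%E].

Definition inner f g : R[i] := Cintegral (fun x => f x * conjc (g x)).

Definition L2norm f : R :=
  Num.sqrt (\int[lebesgue_rV]_(x in Om) (normc (f x) ^+ 2)).

Definition basis_vec j : 'rV[R]_n := delta_mx ord0 j.

Fixpoint Ck k (h : 'rV[R]_n -> R) : Prop :=
  continuous h /\
  if k is k'.+1 then
    forall j, (forall x, derivable h x (basis_vec j)) /\
              Ck k' ('D_(basis_vec j) h)
  else True.

Definition smooth (h : 'rV[R]_n -> R) := forall k, Ck k h.

Definition test_fun phi :=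
  [/\ smooth (fun x => complex.Re (phi x)),
      smooth (fun x => complex.Im (phi x)),
      compact (closure [set x | phi x != 0]) &
      closure [set x | phi x != 0] `<=` Om].

Definition partial j phi : 'rV[R]_n -> R[i] := fun x =>
  'D_(basis_vec j) (fun y => complex.Re (phi y)) x +i*
  'D_(basis_vec j) (fun y => complex.Im (phi y)) x.

Definition is_wpartial j f g :=
  L2 g /\ forall phi, test_fun phi ->
    Cintegral (fun x => f x * partial j phi x) =
    - Cintegral (fun x => g x * phi x).

(* The weak partial derivative in L^2, meaningful if there is one, in which
   case it is unique up to equality almost everywhere on Om. *)
Definition wpartial j f : 'rV[R]_n -> R[i] :=
  xget (fun=> 0) [set g | is_wpartial j f g].

Definition H1 f := L2 f /\ forall j, exists g, is_wpartial j f g.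

Definition H2 f := H1 f /\ forall j, H1 (wpartial j f).

Definition H2norm f : R :=
  Num.sqrt (L2norm f ^+ 2 + \sum_j L2norm (wpartial j f) ^+ 2 +
            \sum_j \sum_k L2norm (wpartial k (wpartial j f)) ^+ 2).

(* Closure of the test functions in H^1. *)
Definition H10 f :=
  H1 f /\ exists phi_ : nat -> 'rV[R]_n -> R[i],
    [/\ forall m, test_fun (phi_ m),
        L2norm (f \- phi_ m) @[m --> \oo] --> 0 &
        forall j, L2norm (wpartial j f \- partial j (phi_ m)) @[m --> \oo] --> 0].

Definition laplacian f : 'rV[R]_n -> R[i] :=
  fun x => \sum_j wpartial j (wpartial j f) x.

(* Since no regularity of the boundary is assumed, an eigenfunction need not
   belong to H^2: as usual, - Laplacian w = l w is understood in the weak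
   sense. *)
Definition dirichlet_eigenfunction w (l : R) :=
  [/\ H10 w, L2norm w != 0 &
      forall v, H10 v ->
        \sum_j inner (wpartial j w) (wpartial j v) = l%:C * inner w v].

Definition orthonormal_basis (w : nat -> 'rV[R]_n -> R[i]) :=
  [/\ forall k, L2 (w k),
      forall k m, inner (w k) (w m) = (k == m)%:R &
      forall f, L2 f ->
        L2norm (fun x => f x - \sum_(k < m) inner f (w k) * w k x)
          @[m --> \oo] --> 0].

(* u \in C([0, oo); H^2 \cap H^1_0) *)
Definition C0_H2H10 (u : R -> 'rV[R]_n -> R[i]) :=
  forall t, 0 <= t ->
    [/\ H2 (u t), H10 (u t) &
        H2norm (u s \- u t) @[s --> within [set s | 0 <= s] (nbhs t)] --> 0].

(* u \in C^1([0, oo); L^2) with derivative du, one-sided at t = 0 *)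
Definition C1_L2 (u du : R -> 'rV[R]_n -> R[i]) :=
  forall t, 0 <= t ->
    [/\ L2 (u t), L2 (du t),
        L2norm (fun x => ((s - t)^-1)%:C * (u s x - u t x) - du t x)
          @[s --> within [set s | 0 <= s /\ s != t] (nbhs t)] --> 0 &
        L2norm (du s \- du t)
          @[s --> within [set s | 0 <= s] (nbhs t)] --> 0].

Definition controlled_CGL (lambda alpha kappa beta gamma mu p : R) (N : nat)
    (w : nat -> 'rV[R]_n -> R[i]) (u du : R -> 'rV[R]_n -> R[i]) :=
  forall t, 0 < t -> {ae lebesgue_rV, forall x, Om x ->
    du t x - (lambda +i* alpha) * laplacian (u t) x
    + (kappa +i* beta) * (normc (u t x) `^ p)%:C * u t x - gamma%:C * u t x
    = - mu%:C * \sum_(k < N) inner (u t) (w k) * w k x}.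

(* Smooth solutions of the initial boundary value problem: the Dirichlet
   condition is u t \in H^1_0. *)
Definition solution (lambda alpha kappa beta gamma mu p : R) (N : nat)
    (w : nat -> 'rV[R]_n -> R[i]) (u0 : 'rV[R]_n -> R[i])
    (u : R -> 'rV[R]_n -> R[i]) :=
  exists du, [/\ C0_H2H10 u, C1_L2 u du,
    controlled_CGL lambda alpha kappa beta gamma mu p N w u du &
    {ae lebesgue_rV, forall x, Om x -> u 0 x = u0 x}].

End function_spaces.

(* Main.v *)
Require Import Defs.
From mathcomp Require Import all_boot all_order all_algebra.
From mathcomp Require Import complex.
From mathcomp Require Import all_classical all_reals all_analysis.
From mathcomp Require Import measurable_realfun ring lra.
Import Order.TTheory GRing.Theory Num.Theory.
Import numFieldNormedType.Exports.
Import ComplexField ComplexField.Normc.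
Local Open Scope classical_set_scope.
Local Open Scope ring_scope.
Set Implicit Arguments.
Unset Strict Implicit.
Unset Printing Implicit Defensive.

(** The proof is an energy estimate.  Pairing the equation with u(t) in L^2 and
taking real parts gives, for t > 0,

  (1/2) d/dt |u|^2 = - lambda |grad u|^2 - kappa int |u|^(p+2)
                     + gamma |u|^2 - mu sum_(k<N) |(u,w_k)|^2.

The dispersive coefficients alpha and beta disappear because (Delta u, u) is
real ([Re_inner_laplacian]) and |u|^p u conj(u) is real.  The nonlinear term
has the good sign.  Since mu >= gamma, the control absorbs the first N modes of
gamma |u|^2, and what is left is gamma (|u|^2 - sum_(k<N) |(u,w_k)|^2).
On the remaining modes the Dirichlet form dominates ([spectral_gap]):

  lam_N (|u|^2 - sum_(k<N) |(u,w_k)|^2) <= |grad u|^2,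

so (1/2) d/dt |u|^2 <= - (lambda - gamma / lam_N) |grad u|^2, and the same
inequality with N = 0, which is the Poincare inequality
lam_0 |u|^2 <= |grad u|^2, turns the right-hand side into a multiple of |u|^2
([energy_dissipation]).  The decay follows because exp(om t) |u(t)|^2 is
nonincreasing ([Gronwall_decay]).

Two points need care.  First, [spectral_gap] uses the eigenvalue equation in
its weak form only: a Bessel inequality for the gradients comes from expanding
the square of grad u - sum_k (u,w_k) grad w_k, and Parseval then lets the number
of modes tend to infinity.  Second, nothing says a priori that |u|^(p+2) is
integrable.  The equation itself shows that (kappa + i beta) |u|^p u agrees
almost everywhere with a function of L^2, and it is that function which is
paired with u. *)

(** * Real and imaginary parts *)

Section complex.
Context {R : realType}.
Implicit Types z c : R[i].
Local Notation Re := complex.Re.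
Local Notation Im := complex.Im.

Lemma ReM z c : Re (z * c) = Re z * Re c - Im z * Im c.
Proof. by case: z c => a b [x y]. Qed.
Lemma ImM z c : Im (z * c) = Re z * Im c + Im z * Re c.
Proof. by case: z c => a b [x y]. Qed.
Lemma ReD z c : Re (z + c) = Re z + Re c.
Proof. by case: z c => a b [x y]. Qed.
Lemma ImD z c : Im (z + c) = Im z + Im c.
Proof. by case: z c => a b [x y]. Qed.
Lemma ReN z : Re (- z) = - Re z. Proof. by case: z. Qed.
Lemma ImN z : Im (- z) = - Im z. Proof. by case: z. Qed.
Lemma ReJ z : Re (conjc z) = Re z. Proof. by case: z. Qed.
Lemma ImJ z : Im (conjc z) = - Im z. Proof. by case: z. Qed.
Lemma sqr_normcE z : normc z ^+ 2 = Re z ^+ 2 + Im z ^+ 2.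
Proof. by case: z => a b /=; rewrite sqr_sqrtr// addr_ge0// sqr_ge0. Qed.
Lemma complexP z c : Re z = Re c -> Im z = Im c -> z = c.
Proof. by case: z c => a b [x y] /= -> ->. Qed.
Lemma conjcB z c : conjc (z - c) = conjc z - conjc c.
Proof. exact: rmorphB. Qed.
Lemma conjcM z c : conjc (z * c) = conjc z * conjc c.
Proof. exact: rmorphM. Qed.
Lemma ReZ (a : R) z : Re (a%:C%C * z) = a * Re z.
Proof. by rewrite ReM /= mul0r subr0. Qed.
Lemma sqr_normc_real (a : R) : normc (a%:C%C) ^+ 2 = a ^+ 2.
Proof. by rewrite sqr_normcE /= expr0n addr0. Qed.

Lemma normr_mulD_le (a b c d : R) :
  `|a * c + b * d| <= a ^+ 2 + b ^+ 2 + (c ^+ 2 + d ^+ 2).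
Proof.
have := (sqr_ge0 (a - c), sqr_ge0 (a + c), sqr_ge0 (b - d), sqr_ge0 (b + d)).
by move=> [[[]]] *; rewrite ler_norml; nra.
Qed.

Definition ReImE := (ReM, ImM, ReD, ImD, ReN, ImN, ReJ, ImJ).

Lemma Re_sum I (r : seq I) (F : I -> R[i]) :
  Re (\sum_(i <- r) F i) = \sum_(i <- r) Re (F i).
Proof. exact: (big_morph _ ReD). Qed.

Lemma conjc_sum I (r : seq I) (F : I -> R[i]) :
  conjc (\sum_(i <- r) F i) = \sum_(i <- r) conjc (F i).
Proof. exact: (big_morph _ (rmorphD _) (conjc0 _)). Qed.

Lemma real_complex_sum I (r : seq I) (F : I -> R) :
  (\sum_(i <- r) F i)%:C%C = \sum_(i <- r) (F i)%:C%C.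
Proof. exact: (big_morph _ (rmorphD _) (rmorph0 _)). Qed.

End complex.

(** * The inner product of L^2 *)

Section L2.
Context {R : realType} {n : nat}.
Variable Om : set 'rV[R]_n.
Hypothesis mOm : measurable Om.
Implicit Types f g h : 'rV[R]_n -> R[i].
Local Notation Re := complex.Re.
Local Notation Im := complex.Im.
Local Notation mu := (@lebesgue_rV R n).

(** Componentwise, because [Cintegral] integrates the real and imaginary parts
separately. *)
Definition Cintegrable h :=
  mu.-integrable Om (EFin \o (fun x => Re (h x))) /\
  mu.-integrable Om (EFin \o (fun x => Im (h x))).

Lemma L2_sqr_integrable f : L2 Om f ->
  mu.-integrable Om (EFin \o (fun x => normc (f x) ^+ 2)).
Proof.
case=> mR mI foo; apply/integrableP; split.
  apply/measurable_EFinP.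
  under eq_fun do rewrite sqr_normcE.
  by apply: measurable_funD; exact: measurable_funX.
by under eq_integral do rewrite /= ger0_norm ?sqr_ge0//.
Qed.

Lemma Cintegrable_mul f g : L2 Om f -> L2 Om g ->
  Cintegrable (fun x => f x * conjc (g x)).
Proof.
move=> Lf Lg.
have [[fR fI _] [gR gI _]] := (Lf, Lg).
have If := L2_sqr_integrable Lf; have Ig := L2_sqr_integrable Lg.
split; apply: le_integrable (integrableD mOm If Ig) => //.
- apply/measurable_EFinP; under eq_fun do rewrite !ReImE mulrN opprK.
  by apply: measurable_funD; exact: measurable_funM.
- move=> x _; rewrite /= lee_fin [leRHS]ger0_norm ?addr_ge0 ?sqr_ge0//.
  by rewrite !sqr_normcE !ReImE mulrN opprK normr_mulD_le.
- apply/measurable_EFinP; under eq_fun do rewrite !ReImE.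
  by apply: measurable_funD; apply: measurable_funM => //; apply: measurableT_comp.
- move=> x _; rewrite /= lee_fin [leRHS]ger0_norm ?addr_ge0 ?sqr_ge0//.
  have := normr_mulD_le (Re (f x)) (Im (f x)) (- Im (g x)) (Re (g x)).
  by rewrite !sqr_normcE !ReImE sqrrN [X in _ <= _ + X]addrC.
Qed.

Lemma eq_Cintegral f g : (forall x, Om x -> f x = g x) ->
  Cintegral Om f = Cintegral Om g.
Proof.
by move=> fg; rewrite /Cintegral; congr Complex; apply: eq_Rintegral => x /[!inE] /fg ->.
Qed.

Lemma CintegralD f g : Cintegrable f -> Cintegrable g ->
  Cintegral Om (fun x => f x + g x) = Cintegral Om f + Cintegral Om g.
Proof.
move=> [fR fI] [gR gI]; apply: complexP; rewrite ReImE /= -RintegralD//.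
  by apply: eq_Rintegral => x _; rewrite ReImE.
by apply: eq_Rintegral => x _; rewrite ReImE.
Qed.

Lemma CintegralZ c f : Cintegrable f ->
  Cintegral Om (fun x => c * f x) = c * Cintegral Om f.
Proof.
move=> [fR fI].
have I r (h' : 'rV[R]_n -> R) : mu.-integrable Om (EFin \o h') ->
   mu.-integrable Om (EFin \o (fun x => r * h' x)) by move=> /(integrableZl mOm r).
apply: complexP; rewrite ReImE /= -!RintegralZl// -(RintegralB, RintegralD)//; try exact: I.
  by apply: eq_Rintegral => x _; rewrite ReImE.
by apply: eq_Rintegral => x _; rewrite ReImE.
Qed.

Lemma CintegralJ f : Cintegrable f ->
  Cintegral Om (fun x => conjc (f x)) = conjc (Cintegral Om f).
Proof.
move=> [fR fI]; apply: complexP; rewrite ReImE /=.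
  by apply: eq_Rintegral => x _; rewrite ReImE.
by rewrite -mulN1r -RintegralZl//; apply: eq_Rintegral => x _; rewrite ReImE mulN1r.
Qed.

Lemma L2D f g : L2 Om f -> L2 Om g -> L2 Om (fun x => f x + g x).
Proof.
move=> Lf Lg.
have [[fR fI _] [gR gI _]] := (Lf, Lg).
have If := L2_sqr_integrable Lf; have Ig := L2_sqr_integrable Lg.
have mR : measurable_fun Om (fun x => Re (f x + g x)).
  by under eq_fun do rewrite ReImE; exact: measurable_funD.
have mI : measurable_fun Om (fun x => Im (f x + g x)).
  by under eq_fun do rewrite ReImE; exact: measurable_funD.
split=> //.
suff /integrableP[_] : mu.-integrable Om (EFin \o (fun x => normc (f x + g x) ^+ 2)).
  by under eq_integral do rewrite /= ger0_norm ?sqr_ge0//.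
apply: le_integrable (integrableZl mOm 2 (integrableD mOm If Ig)) => //.
  apply/measurable_EFinP; under eq_fun do rewrite sqr_normcE.
  by apply: measurable_funD; exact: measurable_funX.
move=> x _; rewrite /= lee_fin [leLHS]ger0_norm ?sqr_ge0//.
rewrite [leRHS]ger0_norm ?mulr_ge0 ?addr_ge0 ?sqr_ge0//.
have := (sqr_ge0 (Re (f x) - Re (g x)), sqr_ge0 (Im (f x) - Im (g x))).
by rewrite !sqr_normcE !ReImE => -[] *; nra.
Qed.

Lemma L2Z c f : L2 Om f -> L2 Om (fun x => c * f x).
Proof.
move=> Lf; have [fR fI _] := Lf.
have If := L2_sqr_integrable Lf.
have mR : measurable_fun Om (fun x => Re (c * f x)).
  by under eq_fun do rewrite ReImE; apply: measurable_funB; exact: measurable_funM.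
have mI : measurable_fun Om (fun x => Im (c * f x)).
  by under eq_fun do rewrite ReImE; apply: measurable_funD; exact: measurable_funM.
split=> //.
suff /integrableP[_] : mu.-integrable Om (EFin \o (fun x => normc (c * f x) ^+ 2)).
  by under eq_integral do rewrite /= ger0_norm ?sqr_ge0//.
have := integrableZl mOm (normc c ^+ 2) If; apply: eq_integrable => // x _ /=.
by rewrite normcM exprMn EFinM.
Qed.

Lemma L20 : L2 Om (fun=> 0).
Proof.
split; [exact: measurable_cst..|].
by under eq_integral do rewrite normc0 expr0n/=; rewrite integral0.
Qed.

Lemma L2B f g : L2 Om f -> L2 Om g -> L2 Om (fun x => f x - g x).
Proof.
move=> Lf /(L2Z (-1)) Lg; have := L2D Lf Lg.
by congr L2; apply/funext => x; rewrite mulN1r.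
Qed.

Lemma L2_sum I (r : seq I) (F : I -> 'rV[R]_n -> R[i]) :
  (forall i, L2 Om (F i)) -> L2 Om (fun x => \sum_(i <- r) F i x).
Proof.
move=> LF; elim: r => [|i r IH].
  by under eq_fun do rewrite big_nil; exact: L20.
by under eq_fun do rewrite big_cons; exact: L2D.
Qed.

Lemma eq_inner f f' g g' : (forall x, Om x -> f x = f' x) ->
  (forall x, Om x -> g x = g' x) -> inner Om f g = inner Om f' g'.
Proof. by move=> ff gg; apply: eq_Cintegral => x Ox; rewrite ff// gg. Qed.

Lemma innerDl f f' g : L2 Om f -> L2 Om f' -> L2 Om g ->
  inner Om (fun x => f x + f' x) g = inner Om f g + inner Om f' g.
Proof.
move=> Lf Lf' Lg; rewrite /inner -CintegralD; try exact: Cintegrable_mul.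
by apply: eq_Cintegral => x _; rewrite mulrDl.
Qed.

Lemma innerZl c f g : L2 Om f -> L2 Om g ->
  inner Om (fun x => c * f x) g = c * inner Om f g.
Proof.
move=> Lf Lg; rewrite /inner -CintegralZ; last exact: Cintegrable_mul.
by apply: eq_Cintegral => x _; rewrite mulrA.
Qed.

Lemma innerJ f g : L2 Om f -> L2 Om g -> inner Om g f = conjc (inner Om f g).
Proof.
move=> Lf Lg; rewrite /inner -CintegralJ; last exact: Cintegrable_mul.
by apply: eq_Cintegral => x _; rewrite rmorphM /= conjcK mulrC.
Qed.

Lemma inner0l g : inner Om (fun=> 0) g = 0.
Proof.
rewrite /inner /Cintegral; apply: complexP => /=;
  under eq_Rintegral do rewrite mul0r /=; by rewrite Rintegral_cst// mul0r.
Qed.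

Lemma innerBl f f' g : L2 Om f -> L2 Om f' -> L2 Om g ->
  inner Om (fun x => f x - f' x) g = inner Om f g - inner Om f' g.
Proof.
move=> Lf Lf' Lg; rewrite -[in RHS]mulN1r -innerZl// -innerDl//; last exact: L2Z.
by apply: eq_inner => // x _; rewrite mulN1r.
Qed.

Lemma innerBr f g g' : L2 Om f -> L2 Om g -> L2 Om g' ->
  inner Om f (fun x => g x - g' x) = inner Om f g - inner Om f g'.
Proof.
move=> Lf Lg Lg'; have Lgg := L2B Lg Lg'.
by rewrite (innerJ Lgg Lf) innerBl// conjcB -!innerJ.
Qed.

Lemma innerZr c f g : L2 Om f -> L2 Om g ->
  inner Om f (fun x => c * g x) = conjc c * inner Om f g.
Proof.
move=> Lf Lg; have Lcg := L2Z c Lg.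
by rewrite (innerJ Lcg Lf) innerZl// conjcM -innerJ.
Qed.

Lemma inner_suml I (r : seq I) (F : I -> 'rV[R]_n -> R[i]) g :
  (forall i, L2 Om (F i)) -> L2 Om g ->
  inner Om (fun x => \sum_(i <- r) F i x) g = \sum_(i <- r) inner Om (F i) g.
Proof.
move=> LF Lg; elim: r => [|i r IH].
  by under eq_fun do rewrite big_nil; rewrite big_nil inner0l.
under eq_fun do rewrite big_cons; rewrite innerDl ?big_cons ?IH//.
exact: L2_sum.
Qed.

Lemma L2norm_ge0 f : 0 <= L2norm Om f.
Proof. exact: sqrtr_ge0. Qed.

Lemma sqr_L2norm f : L2norm Om f ^+ 2 = \int[mu]_(x in Om) (normc (f x) ^+ 2).
Proof. by rewrite sqr_sqrtr// Rintegral_ge0// => x _; rewrite sqr_ge0. Qed.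

Lemma inner_self f : inner Om f f = (L2norm Om f ^+ 2)%:C%C.
Proof.
rewrite sqr_L2norm; apply: complexP => /=.
  by apply: eq_Rintegral => x _; rewrite sqr_normcE !ReImE; ring.
under eq_Rintegral do rewrite !ReImE mulrN mulrC addNr.
by rewrite Rintegral_cst// mul0r.
Qed.

Lemma L2norm_distC f g :
  L2norm Om (fun x => f x - g x) = L2norm Om (fun x => g x - f x).
Proof.
by congr Num.sqrt; apply: eq_Rintegral => x _; rewrite -opprB normcN.
Qed.

Lemma Re_innerC f g : L2 Om f -> L2 Om g -> Re (inner Om g f) = Re (inner Om f g).
Proof. by move=> Lf Lg; rewrite (innerJ Lf Lg) ReJ. Qed.

Lemma sqr_L2normB f g : L2 Om f -> L2 Om g ->
  L2norm Om (fun x => f x - g x) ^+ 2 =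
  L2norm Om f ^+ 2 - 2 * Re (inner Om f g) + L2norm Om g ^+ 2.
Proof.
move=> Lf Lg; have Lfg := L2B Lf Lg.
have := inner_self (fun x => f x - g x).
rewrite innerBl// !innerBr// (innerJ Lf Lg) !inner_self => /(congr1 (@complex.Re R)).
rewrite !ReImE /= => <-; ring.
Qed.

Lemma L2normZ c f : L2 Om f ->
  L2norm Om (fun x => c * f x) = normc c * L2norm Om f.
Proof.
move=> Lf; have n0 : 0 <= normc c by case: c => a b /=; exact: sqrtr_ge0.
apply/eqP; rewrite -(@eqrXn2 _ 2)// ?L2norm_ge0 ?mulr_ge0 ?L2norm_ge0//.
rewrite exprMn !sqr_L2norm -RintegralZl//; last exact: L2_sqr_integrable.
by apply/eqP/eq_Rintegral => x _; rewrite normcM exprMn.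
Qed.

(** The limits below are taken of real parts, with complex coefficients moved
into one of the two arguments. *)
Lemma Cauchy_Schwarz f g : L2 Om f -> L2 Om g ->
  `|Re (inner Om f g)| <= L2norm Om f * L2norm Om g.
Proof.
move=> Lf Lg; set r := Re _; set a := L2norm Om f; set b := L2norm Om g.
have a0 : 0 <= a by exact: L2norm_ge0.
have b0 : 0 <= b by exact: L2norm_ge0.
have Q (s : R) : 0 <= a ^+ 2 - 2 * s * r + s ^+ 2 * b ^+ 2.
  have := sqr_ge0 (L2norm Om (fun x => f x - s%:C%C * g x)).
  rewrite sqr_L2normB//; last exact: L2Z.
  rewrite innerZr// L2normZ// exprMn sqr_normc_real conjc_real ReZ -/r -/a -/b; lra.
rewrite -(@ler_pXn2r _ 2) ?nnegrE ?mulr_ge0// -normrX ger0_norm ?sqr_ge0// exprMn.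
(* The discriminant of the quadratic polynomial in Q is nonpositive.  If b = 0
   the polynomial is affine and takes negative values unless r = 0. *)
have [b00|b00] := eqVneq b 0.
  have [->|r0] := eqVneq r 0; first by rewrite expr0n/= mulr_ge0// sqr_ge0.
  have := Q ((a ^+ 2 + 1) / r / 2).
  rewrite b00 (_ : 2 * _ * r = a ^+ 2 + 1); last by field.
  by rewrite expr0n /= mulr0; lra.
have b2 : 0 < b ^+ 2 by rewrite exprn_gt0// lt_def b00.
have := Q (r / b ^+ 2).
rewrite (_ : _ + _ = a ^+ 2 - r ^+ 2 / b ^+ 2); last by field.
by rewrite subr_ge0 ler_pdivrMr.
Qed.

End L2.

(** * Orthogonal expansions and limits in L^2 *)

Section Bessel.
Context {R : realType} {n : nat}.
Variable Om : set 'rV[R]_n.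
Hypothesis mOm : measurable Om.
Implicit Types f g h : 'rV[R]_n -> R[i].
Local Notation Re := complex.Re.

(** Bessel's identity for vector-valued functions.  The index j runs over the
components, so that one statement serves for the basis itself (a single
component, a = 1) and for the gradients of the eigenfunctions (one component for
each partial derivative, a = lam), which are orthogonal but not normalized.
The c k are the Fourier coefficients.  Adding the terms one by one, the new term
is orthogonal to those already subtracted. *)
Lemma sum_sqr_L2normB_ortho (J : finType) (f : J -> 'rV[R]_n -> R[i])
    (g : nat -> J -> 'rV[R]_n -> R[i]) (a : nat -> R) (c : nat -> R[i]) m :
  (forall j, L2 Om (f j)) -> (forall k j, L2 Om (g k j)) ->
  (forall k, \sum_j inner Om (f j) (g k j) = (a k)%:C%C * c k) ->
  (forall k l, \sum_j inner Om (g k j) (g l j) = (a k)%:C%C * (k == l)%:R) ->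
  \sum_j L2norm Om (fun x => f j x - \sum_(k < m) c k * g k j x) ^+ 2 =
  \sum_j L2norm Om (f j) ^+ 2 - \sum_(k < m) a k * normc (c k) ^+ 2.
Proof.
move=> Lf Lg fg gg.
have LS m' j : L2 Om (fun x => \sum_(k < m') c k * g k j x).
  by apply: L2_sum => // k; exact: L2Z.
have LZ k j : L2 Om (fun x => c k * g k j x) by exact: L2Z.
elim: m => [|m IH].
  rewrite big_ord0 subr0; apply: eq_bigr => j _.
  by under eq_fun do rewrite big_ord0 subr0.
pose F j x := f j x - \sum_(k < m) c k * g k j x.
have LF j : L2 Om (F j) by exact: L2B.
transitivity (\sum_j L2norm Om (fun x => F j x - c m * g m j x) ^+ 2).
  apply: eq_bigr => j _; congr (L2norm Om _ ^+ 2); apply/funext => x.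
  by rewrite big_ord_recr /= /F opprD addrA.
under eq_bigr => j _ do
  rewrite sqr_L2normB ?L2normZ ?innerZr ?exprMn//.
rewrite big_split sumrB /= IH -!mulr_sumr -Re_sum -mulr_sumr.
have -> : \sum_j inner Om (F j) (g m j) = (a m)%:C%C * c m.
  under eq_bigr => j _ do rewrite innerBl// inner_suml//.
  rewrite sumrB fg exchange_big /= big1 ?subr0// => k _.
  under eq_bigr => j _ do rewrite innerZl//.
  by rewrite -mulr_sumr gg (ltn_eqF (ltn_ord k)) !mulr0.
have -> : \sum_j L2norm Om (g m j) ^+ 2 = a m.
  have := gg m m; rewrite eqxx mulr1.
  move/(congr1 (@complex.Re R)); rewrite Re_sum -[X in _ = X]/(a m) => <-.
  by apply: eq_bigr => j _; rewrite inner_self.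
rewrite big_ord_recr /= mulrCA ReZ.
have -> : Re (conjc (c m) * c m) = normc (c m) ^+ 2.
  by rewrite sqr_normcE !ReImE; ring.
ring.
Qed.

(** The pairing is required to make sense eventually along F only, because
solutions are controlled at nonnegative times only. *)
Lemma cvg_Re_inner T (F : set_system T) {FF : Filter F}
    (g_ : T -> 'rV[R]_n -> R[i]) h f :
  (\forall t \near F, L2 Om (g_ t)) -> L2 Om f -> L2 Om h ->
  L2norm Om (fun x => g_ t x - f x) @[t --> F] --> 0 ->
  Re (inner Om (g_ t) h) @[t --> F] --> Re (inner Om f h).
Proof.
move=> Lg Lf Lh fg; apply/subr_cvg0/norm_cvg0P.
have fgh : L2norm Om (fun x => g_ t x - f x) * L2norm Om h @[t --> F] --> 0.
  by rewrite -(mul0r (L2norm Om h)); apply: cvgM (cvg_cst _).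
apply: (squeeze_cvgr _ (cvg_cst 0) fgh).
apply: filterS Lg => t Lgt; apply/andP; split; first exact: normr_ge0.
by have := Cauchy_Schwarz mOm (L2B mOm Lgt Lf) Lh; rewrite innerBl// ReD ReN.
Qed.

Lemma cvg_sqr_L2norm T (F : set_system T) {FF : Filter F}
    (g_ : T -> 'rV[R]_n -> R[i]) f :
  (\forall t \near F, L2 Om (g_ t)) -> L2 Om f ->
  L2norm Om (fun x => g_ t x - f x) @[t --> F] --> 0 ->
  L2norm Om (g_ t) ^+ 2 @[t --> F] --> L2norm Om f ^+ 2.
Proof.
move=> Lg Lf fg.
have C1 : 2 * Re (inner Om (g_ t) f) @[t --> F] --> 2 * L2norm Om f ^+ 2.
  have -> : L2norm Om f ^+ 2 = Re (inner Om f f) by rewrite inner_self.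
  by apply: (cvgM (cvg_cst _)); exact: cvg_Re_inner.
have C2 : L2norm Om (fun x => g_ t x - f x) ^+ 2 @[t --> F] --> 0.
  by rewrite -(mul0r 0); apply: cvgM.
have C : 2 * Re (inner Om (g_ t) f) + L2norm Om (fun x => g_ t x - f x) ^+ 2 -
    L2norm Om f ^+ 2 @[t --> F] --> 2 * L2norm Om f ^+ 2 + 0 - L2norm Om f ^+ 2.
  by apply: cvgB; [exact: cvgD|exact: cvg_cst].
have -> : L2norm Om f ^+ 2 = 2 * L2norm Om f ^+ 2 + 0 - L2norm Om f ^+ 2 by ring.
apply: (cvg_trans _ C).
apply: near_eq_cvg; near=> t.
have Lgt : L2 Om (g_ t) by near: t.
rewrite sqr_L2normB//; ring.
Unshelve. all: by end_near. Qed.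

(** [wpartial] is a choice made by [xget], so any existing weak derivative
guarantees that the chosen one is a weak derivative too. *)
Lemma wpartialP j f : H1 Om f -> is_wpartial Om j f (wpartial Om j f).
Proof.
by case=> _ /(_ j) [g gf]; apply: (@xgetPex _ (fun=> 0) (is_wpartial Om j f));
  exists g.
Qed.

Lemma L2_wpartial j f : H1 Om f -> L2 Om (wpartial Om j f).
Proof. by move=> /(wpartialP j)[]. Qed.

Lemma H10_H1 f : H10 Om f -> H1 Om f. Proof. by case. Qed.
Lemma H10_L2 f : H10 Om f -> L2 Om f. Proof. by case=> -[]. Qed.

(** * Parseval and the spectral gap *)

Section spectral.
Variables (w : nat -> 'rV[R]_n -> R[i]) (lam : nat -> R).
Hypothesis hw : orthonormal_basis Om w.

Lemma Parseval f : L2 Om f ->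
  \sum_(k < m) normc (inner Om f (w k)) ^+ 2 @[m --> \oo] --> L2norm Om f ^+ 2.
Proof.
move=> Lf; have [Lw ww /(_ f Lf) cf] := hw.
have C : L2norm Om f ^+ 2 -
    L2norm Om (fun x => f x - \sum_(k < m) inner Om f (w k) * w k x) ^+ 2
    @[m --> \oo] --> L2norm Om f ^+ 2.
  rewrite -[X in _ --> X]subr0 -[X in _ - X](mul0r 0).
  by apply: cvgB; [exact: cvg_cst|apply: cvgM].
apply: (cvg_trans _ C); apply: near_eq_cvg; near=> m.
have := @sum_sqr_L2normB_ortho 'I_1 (fun=> f) (fun k _ => w k) (fun=> 1)
  (fun k => inner Om f (w k)) m.
rewrite !big_ord1 => -> //.
- by rewrite opprB addrCA subrr addr0; apply: eq_bigr => k _; rewrite mul1r.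
- by move=> k; rewrite big_ord1 mul1r.
- by move=> k l; rewrite big_ord1 mul1r.
Unshelve. all: by end_near. Qed.

Hypothesis hlam : forall k, dirichlet_eigenfunction Om (w k) (lam k).
Hypothesis lam_ge0 : forall k, 0 <= lam k.
Hypothesis lam_mono : {homo lam : j k / (j <= k)%N >-> j <= k}.

(** Expand the square of grad v - sum_k (v,w_k) grad w_k, which is nonnegative.
The weak eigenvalue equation tested with v, respectively with another
eigenfunction, identifies the scalar products that Bessel's identity needs. *)
Lemma Bessel_grad v m : H10 Om v ->
  \sum_(k < m) lam k * normc (inner Om v (w k)) ^+ 2 <=
  \sum_j L2norm Om (wpartial Om j v) ^+ 2.
Proof.
move=> Hv; have [Lw ww _] := hw.
have Hw k : H10 Om (w k) by have [] := hlam k.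
have Lv := L2_wpartial _ (H10_H1 Hv).
have Lpw k j : L2 Om (wpartial Om j (w k)).
  by exact: (L2_wpartial _ (H10_H1 (Hw k))).
rewrite -subr_ge0.
suff <- : \sum_j L2norm Om (fun x => wpartial Om j v x -
    \sum_(k < m) inner Om v (w k) * wpartial Om j (w k) x) ^+ 2 =
  \sum_j L2norm Om (wpartial Om j v) ^+ 2 -
    \sum_(k < m) lam k * normc (inner Om v (w k)) ^+ 2.
  by apply: sumr_ge0 => j _; exact: sqr_ge0.
apply: (@sum_sqr_L2normB_ortho _ (fun j => wpartial Om j v)
  (fun k j => wpartial Om j (w k)) lam (fun k => inner Om v (w k))) => //.
- move=> k; have [_ _ /(_ v Hv) /(congr1 conjc)] := hlam k.
  rewrite conjcM conjc_real -innerJ//; last exact: H10_L2.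
  by rewrite conjc_sum => <-; apply: eq_bigr => j _; rewrite -innerJ.
- by move=> k l; have [_ _ /(_ _ (Hw l)) ->] := hlam k; rewrite ww.
Qed.

(** Bessel's inequality bounds lam N sum_(N <= k < m) |(v,w_k)|^2 by the Dirichlet
form for each m, since lam is nondecreasing.  By Parseval the sum tends to
|v|^2 minus its first N terms.  The case N = 0 is the Poincare inequality. *)
Lemma spectral_gap v N : H10 Om v ->
  lam N * (L2norm Om v ^+ 2 - \sum_(k < N) normc (inner Om v (w k)) ^+ 2) <=
  \sum_j L2norm Om (wpartial Om j v) ^+ 2.
Proof.
move=> Hv; set c := fun k => normc (inner Om v (w k)) ^+ 2.
have C : lam N * (\sum_(k < m) c k - \sum_(k < N) c k) @[m --> \oo] -->
   lam N * (L2norm Om v ^+ 2 - \sum_(k < N) c k).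
  apply: (cvgM (cvg_cst _)); apply: cvgB; last exact: cvg_cst.
  exact: Parseval (H10_L2 Hv).
apply: cvgr_to_le C _; near=> m.
have Nm : (N <= m)%N by near: m; exact: nbhs_infty_ge.
apply: le_trans (Bessel_grad m Hv).
rewrite -!(big_mkord xpredT c) -(big_mkord xpredT (fun k => lam k * c k)).
rewrite !(big_cat_nat (leq0n N) Nm) /= addrAC subrr add0r mulr_sumr.
rewrite -[leLHS]add0r lerD//.
  by apply: sumr_ge0 => k _; rewrite mulr_ge0// sqr_ge0.
rewrite !big_nat; apply: ler_sum => k /andP[Nk _].
by rewrite ler_wpM2r ?sqr_ge0// lam_mono.
Unshelve. all: by end_near. Qed.

End spectral.
End Bessel.

(** * Test functions and Green's formula *)

Section test_functions.
Context {R : realType} {n : nat}.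
Variable Om : set 'rV[R]_n.
Hypothesis oOm : open Om.
Hypothesis bOm : bounded_set Om.
Implicit Types f g h phi : 'rV[R]_n -> R[i].
Local Notation Re := complex.Re.
Local Notation Im := complex.Im.
Local Notation mu := (@lebesgue_rV R n).

Lemma open_measurable_rV (U : set 'rV[R]_n) : open U -> measurable U.
Proof. exact: sub_sigma_algebra. Qed.

Let mOm : measurable Om := open_measurable_rV oOm.

Lemma continuous_measurable_rV (h : 'rV[R]_n -> R) : continuous h ->
  measurable_fun Om h.
Proof.
move=> ch; apply: (measurability _ (RGenOInfty.measurableE R)) => _ [_ [a ->] <-].
apply: measurableI => //; apply: open_measurable_rV.
by apply: open_comp; [move=> v _; exact: ch|exact: interval_open].
Qed.

Definition cube (M : R) : set 'rV[R]_n :=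
  [set v | forall j, - M <= v ord0 j <= M].

Lemma bounded_subset_cube : exists M : R, 0 <= M /\
  Om `<=` cube M.
Proof.
have [M [_ MOm]] := bOm.
exists (`|M| + 1); split; first by rewrite addr_ge0.
move=> v Ov j; rewrite -ler_norml.
have : `|v| <= `|M| + 1 by apply: MOm => //; rewrite ltr_pwDr// ler_norm.
apply: le_trans; rewrite [leRHS]/Num.norm /= mx_normrE.
by apply/bigmax_geP; right; exists (ord0, j).
Qed.

Lemma cube_compact M : compact (cube M).
Proof.
have := @rV_compact R n (fun=> `[(- M), M]%classic) (fun=> @segment_compact R _ _).
by congr compact; apply/seteqP; split => v /= vM j; move: (vM j); rewrite in_itv.
Qed.

(** A cube has finite measure by the volume formula for boxes. *)
Lemma lebesgue_bounded_lty : (mu Om < +oo)%E.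
Proof.
have [M [M0 OM]] := bounded_subset_cube.
pose a : 'rV[R]_n := \row__ (- M); pose b : 'rV[R]_n := \row__ M.
have Kab : cube M =
    [set v | forall j, a ord0 j <= v ord0 j <= b ord0 j].
  by apply/seteqP; split => v /= vM j; move: (vM j); rewrite !mxE.
have := @lebesgue_rV_box R n a b; rewrite -Kab => E.
apply: (@le_lt_trans _ _ (mu (cube M))).
  apply: le_measure => //; rewrite inE//.
  rewrite -[X in measurable X]setCK; apply: measurableC; apply: open_measurable_rV.
  by rewrite openC; apply: compact_closed; [exact: norm_hausdorff|exact: cube_compact].
rewrite E ?ltry// => j; rewrite !mxE; lra.
Qed.

(** Om lies in a compact cube, on which a function that is continuous on the
whole space is bounded. *)
Lemma continuous_bounded (h : 'rV[R]_n -> R) : continuous h ->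
  exists B, forall x, Om x -> `|h x| <= B.
Proof.
move=> ch; have [M [M0 OM]] := bounded_subset_cube.
have cK : compact (h @` cube M).
  apply: continuous_compact (@cube_compact M).
  exact: continuous_subspaceT.
have [B [_ BK]] := compact_bounded cK.
exists (`|B| + 1) => x /OM Kx; apply: BK; last by exists x.
by rewrite ltr_pwDr// ler_norm.
Qed.

Lemma continuous_L2 f : continuous (fun x => Re (f x)) ->
  continuous (fun x => Im (f x)) -> L2 Om f.
Proof.
move=> cR cI; have [A fA] := continuous_bounded cR.
have [B fB] := continuous_bounded cI.
split; try exact: continuous_measurable_rV.
apply: (@le_lt_trans _ _ (\int[mu]_(x in Om) (cst (A ^+ 2 + B ^+ 2)%:E) x)%E).
  apply: ge0_le_integral => //.
  - by move=> x _; rewrite lee_fin sqr_ge0.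
  - apply/measurable_EFinP; under eq_fun do rewrite sqr_normcE.
    by apply: measurable_funD; apply: measurable_funX; exact: continuous_measurable_rV.
  - move=> x Ox; rewrite lee_fin sqr_normcE lerD//.
    + by have := fA x Ox; rewrite ler_norml => /andP[]; nra.
    + by have := fB x Ox; rewrite ler_norml => /andP[]; nra.
rewrite integral_cst//; have := lebesgue_bounded_lty.
by apply: lte_mul_pinfty; rewrite ?lee_fin ?addr_ge0 ?sqr_ge0.
Qed.

Lemma test_fun_L2 phi : test_fun Om phi -> L2 Om phi.
Proof. by case=> /(_ 0%N)[cR _] /(_ 0%N)[cI _] _ _; exact: continuous_L2. Qed.

Lemma partial_test_fun_L2 j phi : test_fun Om phi -> L2 Om (partial j phi).
Proof.
by case=> /(_ 1%N)[_ /(_ j)[_ [cR _]]] /(_ 1%N)[_ /(_ j)[_ [cI _]]] _ _;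
  exact: continuous_L2.
Qed.

Lemma CkN k (h : 'rV[R]_n -> R) : Ck k h -> Ck k (- h).
Proof.
elim: k h => [|k IH] h [ch dh]; split=> //; try by move=> x; exact/continuousN/ch.
move=> j; have [dj Cj] := dh j; split; first by move=> x; exact: derivableN.
rewrite (_ : 'D_ _ _ = - 'D_(basis_vec R j) h); first exact: IH.
by apply/funext => x; rewrite deriveN.
Qed.

(** The weak derivative is defined with the bilinear pairing.  Conjugating test
functions passes to the sesquilinear one. *)
Lemma test_funJ phi : test_fun Om phi -> test_fun Om (fun x => conjc (phi x)).
Proof.
case=> sR sI cs sub; have E : [set x | conjc (phi x) != 0] = [set x | phi x != 0].
  by apply/seteqP; split => x /=; rewrite conjc_eq0.
split; rewrite ?E//.
- by under eq_fun do rewrite ReJ.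
- by under eq_fun do rewrite ImJ; move=> k; exact: CkN.
Qed.

Lemma partialJ j phi x : test_fun Om phi ->
  partial j (fun y => conjc (phi y)) x = conjc (partial j phi x).
Proof.
case=> _ /(_ 1%N)[_ /(_ j)[dI _]] _ _; rewrite /partial; apply: complexP => /=.
  by under eq_fun do rewrite ReJ.
under eq_fun do rewrite ImJ.
exact: deriveN.
Qed.

Lemma wpartial_test j f g phi : is_wpartial Om j f g -> test_fun Om phi ->
  inner Om g phi = - inner Om f (partial j phi).
Proof.
move=> [_ ibp] tphi; have E := ibp _ (test_funJ tphi).
have -> : inner Om f (partial j phi) =
    Cintegral Om (fun x => f x * partial j (fun y => conjc (phi y)) x).
  by apply: eq_Cintegral => x _; rewrite partialJ.
by rewrite E opprK.
Qed.

(** The coefficient c sits inside the second argument so that the identity passes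
to the limit using the real parts of the pairings alone. *)
Lemma Re_inner_wpartial (c : R[i]) j f g phi : L2 Om f -> is_wpartial Om j f g ->
  test_fun Om phi ->
  Re (inner Om phi (fun x => c * g x)) =
  - Re (inner Om (partial j phi) (fun x => c * f x)).
Proof.
move=> Lf fg tphi; have [Lg _] := fg.
have Lphi := test_fun_L2 tphi; have Ldphi := partial_test_fun_L2 j tphi.
have E : inner Om (fun x => c * g x) phi =
    - inner Om (fun x => c * f x) (partial j phi).
  rewrite (innerZl mOm c Lg Lphi) (innerZl mOm c Lf Ldphi).
  rewrite (wpartial_test fg tphi).
  exact: mulrN.
apply: etrans (Re_innerC mOm (L2Z mOm c Lg) Lphi) _.
apply: etrans (congr1 (@complex.Re R) E) _; apply: etrans (ReN _) _.
exact: (congr1 -%R (esym (Re_innerC mOm (L2Z mOm c Lf) Ldphi))).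
Qed.

(** Green's formula (Delta f, f) = - |grad f|^2, multiplied by c.  For a test
function phi in place of the second f it is the definition of the weak
derivative.  As f is in H^1_0, test functions approximate it in H^1, and both
sides pass to the limit. *)
Lemma Re_inner_laplacian (c : R[i]) f : H2 Om f -> H10 Om f ->
  Re (inner Om (fun x => c * laplacian Om f x) f) =
  - Re c * \sum_j L2norm Om (wpartial Om j f) ^+ 2.
Proof.
move=> [Hf Hpf] [_ [phi [tphi phif dphif]]].
have Lf : L2 Om f by case: Hf.
have Lp j : L2 Om (wpartial Om j f) by exact: L2_wpartial.
have Lpp j : L2 Om (wpartial Om j (wpartial Om j f)) by exact: L2_wpartial.
have Lphi m := test_fun_L2 (tphi m).
have Ldphi m j := partial_test_fun_L2 j (tphi m).
have step j : Re (inner Om (fun x => c * wpartial Om j (wpartial Om j f) x) f) =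
    - Re c * L2norm Om (wpartial Om j f) ^+ 2.
  set g := fun x => c * wpartial Om j f x.
  set g' := fun x => c * wpartial Om j (wpartial Om j f) x.
  have Lg : L2 Om g by exact: L2Z.
  have Lg' : L2 Om g' by exact: L2Z.
  have cvg_phi : Re (inner Om (phi m) g') @[m --> \oo] --> Re (inner Om f g').
    apply: (cvg_Re_inner mOm) => //; first exact: nearW.
    by under eq_fun do rewrite L2norm_distC; exact: phif.
  have cvg_dphi : Re (inner Om (partial j (phi m)) g) @[m --> \oo] -->
      Re (inner Om (wpartial Om j f) g).
    apply: (cvg_Re_inner mOm) => //; first exact: nearW.
    by under eq_fun do rewrite L2norm_distC; exact: dphif.
  have ibp m : Re (inner Om (phi m) g') = - Re (inner Om (partial j (phi m)) g).
    exact: Re_inner_wpartial (Lp j) (wpartialP j (Hpf j)) (tphi m).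
  rewrite (Re_innerC mOm Lf Lg') -(cvg_lim _ cvg_phi)//.
  under eq_fun do rewrite ibp.
  rewrite (cvg_lim _ (cvgN cvg_dphi))// (Re_innerC mOm Lg (Lp j)).
  rewrite (innerZl mOm c (Lp j) (Lp j)) inner_self//.
  by rewrite mulNr mulrC ReZ mulrC.
transitivity (\sum_j
    Re (inner Om (fun x => c * wpartial Om j (wpartial Om j f) x) f)); last first.
  by rewrite big_distrr; apply: eq_bigr => j _; exact: step.
rewrite -Re_sum -inner_suml//; last by move=> j; exact: L2Z.
by congr (Re _); apply: eq_inner => // x _; rewrite /laplacian mulr_sumr.
Qed.
End test_functions.

(** * Gronwall's lemma *)

Section Gronwall.
Context {R : realType}.
Implicit Types (E dE : R -> R) (om : R).

(** For t > 0 the constraint s >= 0 is void near t. *)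
Lemma is_derive_within_cvg E (t d : R) : 0 < t ->
  (s - t)^-1 * (E s - E t)
    @[s --> within [set s | 0 <= s /\ s != t] (nbhs t)] --> d ->
  is_derive t 1 E d.
Proof.
move=> t0 Ed; apply/is_derive1_caratheodory.
exists (fun z => if z == t then d else (z - t)^-1 * (E z - E t)); split.
- move=> z; case: eqVneq => [->|zt]; first by rewrite !subrr mulr0.
  by rewrite mulrAC mulVf ?mul1r// subr_eq0.
- rewrite /prop_for /continuous_at eqxx; apply/cvgrPdist_lt => e e0.
  have /cvgrPdist_lt /(_ e e0) H := Ed.
  apply: (@filterS2 _ (nbhs t) _ _ _ _ _ H (lt_nbhsr t0)) => z Hz z0.
  case: eqVneq => [_|zt]; first by rewrite subrr normr0.
  by apply: Hz; split; [exact: ltW|exact: zt].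
- by rewrite eqxx.
Qed.

Lemma cvg_right_within E (d : R) :
  (s - 0)^-1 * (E s - E 0)
    @[s --> within [set s : R | 0 <= s /\ s != 0] (nbhs (0 : R))] --> d ->
  E s @[s --> 0^'+] --> E 0.
Proof.
move=> Ed.
have C : (s - 0)^-1 * (E s - E 0) @[s --> 0^'+] --> d.
  apply/cvgrPdist_lt => e e0; have /cvgrPdist_lt /(_ e e0) H := Ed.
  apply: (@filterS _ (nbhs (0 : R)) _ _ _ _ H) => s + s0; apply.
  by split; [exact: ltW|rewrite gt_eqF].
have C0 : E 0 + s * ((s - 0)^-1 * (E s - E 0)) @[s --> 0^'+] --> E 0 + 0 * d.
  by apply: cvgD; [exact: cvg_cst|apply: cvgM => //; exact: cvg_at_right_filter].
rewrite -[X in _ --> X](addr0 (E 0)) -[X in _ + X](mul0r d).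
apply: (cvg_trans _ C0); apply: near_eq_cvg; near=> s.
have s0 : 0 < s by near: s; exact: nbhs_right_gt.
by rewrite subr0 mulrA divff ?gt_eqF// mul1r addrC subrK.
Unshelve. all: by end_near. Qed.

(** exp(om t) E(t) has a nonpositive derivative for t > 0 and is right-continuous
at 0.  The one-sided difference quotient at t = 0 serves for that continuity. *)
Lemma Gronwall_decay E dE om :
  (forall t : R, 0 <= t -> (s - t)^-1 * (E s - E t)
    @[s --> within [set s | 0 <= s /\ s != t] (nbhs t)] --> dE t) ->
  (forall t : R, 0 < t -> dE t <= - om * E t) ->
  forall t : R, 0 <= t -> E t <= expR (- om * t) * E 0.
Proof.
move=> dEP dEle T; rewrite le_eqVlt => /predU1P[<-|T0].
  by rewrite mulr0 expR0 mul1r.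
have dE_ (t : R) : 0 < t -> is_derive t 1 E (dE t).
  by move=> t0; apply: is_derive_within_cvg => //; exact/dEP/ltW.
pose F (s : R) := expR (om * s) * E s.
have dF (t : R) : 0 < t -> is_derive t 1 F (expR (om * t) * (om * E t + dE t)).
  move=> t0; have ? := dE_ t t0.
  have : is_derive t 1 F (expR (om * t) *: dE t + E t *: (om *: expR (om * t))).
    have dexp : is_derive t 1 (fun s => expR (om * s)) (om *: expR (om * t)).
      have dom : is_derive t 1 (fun s => om * s) (om *: 1) by exact: is_deriveZ.
      apply: is_derive_eq (is_derive1_comp (is_derive_expR (om * t)) dom) _.
      by rewrite /GRing.scale /= mulr1 mulrC.
    exact: is_deriveM.
  move=> dF; apply: (is_derive_eq dF); rewrite /GRing.scale /=; ring.
have cF (t : R) : 0 < t -> {for t, continuous F}.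
  move=> t0; have [dFt _] := dF t t0.
  exact/differentiable_continuous/derivable1_diffP.
have {}cF : {within `[0, T], continuous F}.
  apply/continuous_within_itvP => //; split.
  - by move=> t; rewrite in_itv /= => /andP[t0 _]; exact: cF.
  - apply: cvgM; last exact/cvg_right_within/dEP.
    apply: cvg_at_right_filter.
    apply: (continuous_comp (f := *%R om)); last exact: continuous_expR.
    exact: mulrl_continuous.
  - exact/cvg_at_left_filter/cF.
have : F T <= F 0.
  apply: (ler0_derive1_le_cc _ _ cF); rewrite ?in_itv/= ?lexx ?(ltW T0)//.
  - by move=> x; rewrite in_itv /= => /andP[x0 _]; have [] := dF x x0.
  - move=> x; rewrite in_itv /= => /andP[x0 _]; have ? := dF x x0.
    rewrite derive1E derive_val pmulr_rle0 ?expR_gt0//.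
    by have := dEle x x0; lra.
rewrite /F mulr0 expR0 mul1r mulNr expRN => FT.
by rewrite mulrC ler_pdivlMr ?expR_gt0// mulrC.
Qed.
End Gronwall.

(** * The energy balance *)

Section energy.
Context {R : realType} {n : nat}.
Variable Om : set 'rV[R]_n.
Hypothesis mOm : measurable Om.
Implicit Types f g h : 'rV[R]_n -> R[i].
Local Notation Re := complex.Re.
Local Notation Im := complex.Im.
Local Notation mu := (@lebesgue_rV R n).

Lemma Re_inner_ge0 f g : L2 Om f -> L2 Om g ->
  {ae mu, forall x, Om x -> 0 <= Re (f x * conjc (g x))} ->
  0 <= Re (inner Om f g).
Proof.
move=> Lf Lg fg0; have [Ifg _] := Cintegrable_mul mOm Lf Lg.
have mfg : measurable_fun Om (EFin \o (fun x => Re (f x * conjc (g x)))).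
  exact: measurable_int Ifg.
apply: fine_ge0.
rewrite (@ae_eq_integral _ _ _ mu _
  (fun x => (Num.max 0 (Re (f x * conjc (g x))))%:E))//.
- by apply: integral_ge0 => x _; rewrite lee_fin le_max lexx.
- apply/measurable_EFinP; apply: measurable_maxr => //.
  exact/measurable_EFinP.
- apply: filterS fg0 => x H Ox /=; congr EFin; apply/esym/max_idPr.
  exact: H.
Qed.

Lemma ae_eq_sqr_L2norm f g : L2 Om f -> L2 Om g ->
  {ae mu, forall x, Om x -> f x = g x} ->
  L2norm Om f ^+ 2 = L2norm Om g ^+ 2.
Proof.
move=> Lf Lg fg; rewrite !sqr_L2norm; congr fine.
apply: ae_eq_integral => //.
- by case/integrableP: (L2_sqr_integrable Lf).
- by case/integrableP: (L2_sqr_integrable Lg).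
- by apply: filterS fg => x H Ox /=; rewrite H.
Qed.

(** With the difference quotient q = (u s - u t) / (s - t), the quotient of |u|^2 is
2 Re (q, u t) + (s - t) |q|^2, and |q| stays bounded because q converges in
L^2. *)
Lemma cvg_sqr_L2norm_quotient (u : R -> 'rV[R]_n -> R[i]) (t : R) du :
  (forall s, 0 <= s -> L2 Om (u s)) -> L2 Om du -> 0 <= t ->
  L2norm Om (fun x => ((s - t)^-1)%:C%C * (u s x - u t x) - du x)
    @[s --> within [set s | 0 <= s /\ s != t] (nbhs t)] --> 0 ->
  (s - t)^-1 * (L2norm Om (u s) ^+ 2 - L2norm Om (u t) ^+ 2)
    @[s --> within [set s | 0 <= s /\ s != t] (nbhs t)] -->
    2 * Re (inner Om du (u t)).
Proof.
move=> Lu Ldu t0 C; set F := within _ _.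
have FF : Filter F by exact: within_filter.
pose q s x := ((s - t)^-1)%:C%C * (u s x - u t x).
have Lut := Lu t t0.
have Lq s : 0 <= s -> L2 Om (q s).
  by move=> s0; apply: L2Z => //; apply: L2B => //; exact: Lu.
have nF : \forall s \near F, 0 <= s /\ s != t by exact: withinT.
have nLq : \forall s \near F, L2 Om (q s).
  by apply: filterS nF => s [s0 _]; exact: Lq.
have C1 := cvg_Re_inner (FF := FF) mOm nLq Ldu Lut C.
have C2 := cvg_sqr_L2norm (FF := FF) mOm nLq Ldu C.
have C3 : s - t @[s --> F] --> 0.
  have C0 : (s - t) @[s --> t] --> t - t.
    by apply: cvgB; [exact: cvg_id|exact: cvg_cst].
  by rewrite subrr in C0; exact: cvg_within_filter C0.
have C4 : 2 * Re (inner Om (q s) (u t)) + (s - t) * L2norm Om (q s) ^+ 2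
    @[s --> F] --> 2 * Re (inner Om du (u t)) + 0 * L2norm Om du ^+ 2.
  by apply: cvgD; [apply: (cvgM (cvg_cst _))|apply: cvgM].
rewrite -[X in _ --> X]addr0 -[X in _ + X](mul0r (L2norm Om du ^+ 2)).
apply: (cvg_trans _ C4); apply: near_eq_cvg.
apply: filterS nF => s [s0 st].
have Lus := Lu s s0; have Lqs := Lq s s0.
have st0 : s - t != 0 by rewrite subr_eq0.
rewrite /q innerZl ?L2normZ ?ReZ//; [|exact: L2B..].
rewrite exprMn sqr_normc_real sqr_L2normB// innerBl// ReD ReN inner_self//.
rewrite -[Re (_ ^+ 2)%:C%C]/(L2norm Om (u t) ^+ 2); by field.
Qed.
End energy.

Section dissipation.
Context {R : realType} {n : nat}.
Variable Om : set 'rV[R]_n.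
Hypothesis oOm : open Om.
Hypothesis bOm : bounded_set Om.
Local Notation Re := complex.Re.
Local Notation mu := (@lebesgue_rV R n).
Let mOm : measurable Om := open_measurable_rV oOm.
Variables (w : nat -> 'rV[R]_n -> R[i]) (lam : nat -> R).
Hypothesis hw : orthonormal_basis Om w.
Hypothesis hlam : forall k, dirichlet_eigenfunction Om (w k) (lam k).
Hypothesis lam_gt0 : 0 < lam 0%N.
Hypothesis lam_mono : {homo lam : j k / (j <= k)%N >-> j <= k}.

(** A statement about a single time: dv is the time derivative of the state v, and
nu the strength of the control.  Pairing with v kills alpha and beta, the
nonlinear term is dropped by its sign, the control absorbs the modes below N,
and the spectral gap is used once at N and once at 0. *)
Lemma energy_dissipation (lambda alpha kappa beta gamma nu p : R) N v dv :
  0 <= kappa -> 0 <= gamma <= nu -> gamma / lambda < lam N -> 0 < lambda ->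
  H2 Om v -> H10 Om v -> L2 Om dv ->
  {ae mu, forall x, Om x ->
    dv x - (lambda +i* alpha)%C * laplacian Om v x
    + (kappa +i* beta)%C * (normc (v x) `^ p)%:C%C * v x - gamma%:C%C * v x
    = - nu%:C%C * \sum_(k < N) inner Om v (w k) * w k x} ->
  Re (inner Om dv v) <=
  - ((lambda - gamma / lam N) * lam 0%N) * L2norm Om v ^+ 2.
Proof.
move=> kappa0 /andP[gamma0 gamma_nu] gammaN lambda0 H2v H10v Ldv eqv.
have [[Lv _] Hpv] := H2v; have [Lw _ _] := hw.
have Llap : L2 Om (laplacian Om v).
  by apply: L2_sum => // j; exact: L2_wpartial.
pose P x := \sum_(k < N) inner Om v (w k) * w k x.
have LP : L2 Om P by apply: L2_sum => // k; exact: L2Z.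
pose L x := (lambda +i* alpha)%C * laplacian Om v x.
have LL : L2 Om L by exact: L2Z.
pose G x := gamma%:C%C * v x.
have LG : L2 Om G by exact: L2Z.
pose Q x := nu%:C%C * P x.
have LQ : L2 Om Q by exact: L2Z.
(* By the equation, F is the nonlinear term almost everywhere.  It
   is visibly in L^2, which for |v|^p v is not known beforehand. *)
pose F x := L x + G x - Q x - dv x.
have LF : L2 Om F by apply: L2B => //; apply: L2B => //; exact: L2D.
have F0 : 0 <= Re (inner Om F v).
  apply: Re_inner_ge0 => //; apply: filterS eqv => x + Ox => /(_ Ox) E.
  have -> : F x = (kappa +i* beta)%C * (normc (v x) `^ p)%:C%C * v x.
    move: E; rewrite -/(P x) -/(L x) -/(G x) mulNr -/(Q x) /F => E.
    rewrite -[Q x]opprK -E; ring.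
  rewrite -mulrA -mulrA mulrCA ReZ mulr_ge0 ?powR_ge0// !ReImE /=.
  have := (sqr_ge0 (Re (v x)), sqr_ge0 (complex.Im (v x))) => -[v1 v2].
  rewrite [leRHS](_ : _ =
    kappa * (Re (v x) ^+ 2 + complex.Im (v x) ^+ 2)); last by ring.
  by rewrite mulr_ge0 ?addr_ge0.
have innerP : inner Om P v = (\sum_(k < N) normc (inner Om v (w k)) ^+ 2)%:C%C.
  rewrite inner_suml//; last by move=> k; exact: L2Z.
  rewrite real_complex_sum; apply: eq_bigr => k _.
  rewrite innerZl// (innerJ mOm Lv (Lw k)).
  move: (inner Om v (w k)) => z.
  by rewrite sqr_normcE; apply: complexP; rewrite !ReImE /=; ring.
set S := \sum_(k < N) normc (inner Om v (w k)) ^+ 2 in innerP.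
set D := \sum_j L2norm Om (wpartial Om j v) ^+ 2.
set E := L2norm Om v ^+ 2.
have bal : Re (inner Om dv v) <= - lambda * D + gamma * E - nu * S.
  have FE : inner Om F v =
      inner Om L v + gamma%:C%C * E%:C%C - nu%:C%C * S%:C%C - inner Om dv v.
    rewrite innerBl//; last by apply: L2B => //; exact: L2D.
    rewrite innerBl//; last exact: L2D.
    by rewrite innerDl// (innerZl _ _ LP)// innerP (innerZl _ _ Lv)// inner_self.
  have LE := Re_inner_laplacian oOm bOm (lambda +i* alpha)%C H2v H10v.
  move: F0; rewrite FE 3!ReD 2!ReN 2!ReZ LE.
  rewrite -[Re (lambda +i* alpha)%C]/lambda -[Re E%:C%C]/E -[Re S%:C%C]/S -/D.
  lra.
have lam_ge0 k : 0 <= lam k by apply: (le_trans (ltW lam_gt0)); exact: lam_mono.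
have lamN0 : 0 < lam N by apply: (lt_le_trans lam_gt0); exact: lam_mono.
have gapN : lam N * (E - S) <= D :=
  spectral_gap mOm hw hlam lam_ge0 lam_mono N H10v.
have gap0 : lam 0%N * E <= D.
  have := spectral_gap mOm hw hlam lam_ge0 lam_mono 0 H10v.
  by rewrite big_ord0 subr0.
have S0 : 0 <= S by apply: sumr_ge0 => k _; exact: sqr_ge0.
have c0 : 0 < lambda - gamma / lam N.
  by rewrite subr_gt0 ltr_pdivrMr// mulrC -ltr_pdivrMr.
have gapN' : gamma * (E - S) <= gamma / lam N * D.
  by rewrite -mulrA ler_wpM2l// ler_pdivlMl.
have := ler_wpM2l (ltW c0) gap0.
have : gamma * S <= nu * S by rewrite ler_wpM2r.
rewrite mulNr -mulrA; lra.
Qed.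
End dissipation.

Unset Implicit Arguments.
(* Indices start at 0: w k and lam k stand for omega_(k+1) and lambda_(k+1),
   so lam N is lambda_(N+1) and lam 0 is lambda_1. *)
Theorem theorem3p1 (R : realType) (n : nat) (hn : (0 < n)%N)
    (Om : set 'rV[R]_n) (hOm : is_domain Om) (bOm : bounded_set Om)
    (w : nat -> 'rV[R]_n -> R[i]) (lam : nat -> R)
    (hw : orthonormal_basis Om w)
    (hlam : forall k, dirichlet_eigenfunction Om (w k) (lam k))
    (lam_gt0 : 0 < lam 0%N)
    (lam_mono : {homo lam : j k / (j <= k)%N >-> j <= k})
    (lam_cvg : lam k @[k --> \oo] --> +oo)
    (p lambda kappa gamma alpha beta mu : R)
    (p_gt0 : 0 < p) (lambda_gt0 : 0 < lambda) (kappa_gt0 : 0 < kappa)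
    (gamma_gt0 : 0 < gamma) (hmu : gamma <= mu)
    (N : nat) (N_gt0 : (0 < N)%N) (hN : gamma / lambda < lam N)
    (u0 : 'rV[R]_n -> R[i]) (hu0 : L2 Om u0)
    (u : R -> 'rV[R]_n -> R[i])
    (hu : solution Om lambda alpha kappa beta gamma mu p N w u0 u) :
  exists om : R,
    [/\ 0 < om,
        om = 2 * (lambda - gamma * (lam N)^-1) * lam 0%N &
        forall t : R, 0 <= t ->
          L2norm Om (u t) ^+ 2 <= expR (- om * t) * L2norm Om u0 ^+ 2].
Proof.
have [oOm _ _] := hOm.
have mOm := open_measurable_rV oOm.
have [du [uH2 uC1 ueq u0E]] := hu.
set c := lambda - gamma / lam N.
have lamN0 : 0 < lam N by apply: (lt_le_trans lam_gt0); exact: lam_mono.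
have c0 : 0 < c by rewrite subr_gt0 ltr_pdivrMr// mulrC -ltr_pdivrMr.
exists (2 * c * lam 0%N); split => [|//|t t0]; first by rewrite !mulr_gt0.
have Lu s : 0 <= s -> L2 Om (u s) by move=> /uC1[].
rewrite -(ae_eq_sqr_L2norm mOm (Lu 0 (lexx _)) hu0 u0E).
apply: (@Gronwall_decay _ (fun s => L2norm Om (u s) ^+ 2)
  (fun s => 2 * complex.Re (inner Om (du s) (u s)))) => // {t t0} t t0.
  have [_ Ldu quot _] := uC1 t t0.
  exact: cvg_sqr_L2norm_quotient.
have [H2u H10u _] := uH2 t (ltW t0); have [_ Ldu _ _] := uC1 t (ltW t0).
have gmu : 0 <= gamma <= mu by rewrite ltW.
have := energy_dissipation oOm bOm hw hlam lam_gt0 lam_mono (ltW kappa_gt0)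
  gmu hN lambda_gt0 H2u H10u Ldu (ueq t t0).
rewrite -/c; lra.
Qed.
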